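(* Let $t\ge 1$ and $k\ge 1$ be integers and let $n\ge 0$ be an integer. Then the following identity holds in $\mathbb{N}[q]$: $$[t]_{n,k}=|\mathrm{T}_{n,k}^t,\omega|,$$ where $[t]_{n,k}=\prod_{j=0}^{n-1}[t+jk]_q$ and $|\mathrm{T}_{n,k}^t,\omega|=\sum_{T\in \mathrm{T}_{n,k}^t}\omega(T)$ is the cardinality of the $q$-weighted finite set $(\mathrm{T}_{n,k}^t,\omega)$ of planar rooted trees.
   Context: $\mathbb{N}[q]$ denotes polynomials in $q$ with non-negative integer coefficients. For a positive integer $m$, $[m]_q=\frac{1-q^m}{1-q}=1+q+\dots+q^{m-1}$. Empty products equal $1$. $q$-weighted sets. A $q$-weighted finite set is a pair $(x,\omega)$ with $x$ a finite set and $\omega:x\to\mathbb{N}[q]$ any map; its cardinality is $|x,\omega|=\sum_{i\in x}\omega(i)\in\mathbb{N}[q]$. Trees. $\mathrm{T}_{n,k}^t$ is the set of isomorphism classes of planar rooted trees $T$ (edges are oriented toward the root, and the incoming edges at each vertex are linearly ordered; isomorphisms preserve the root, these orders, and the labels of internal vertices) such that: (1) the set of internal vertices of $T$, i.e. vertices with one outgoing edge and at least one incoming edge, is $\{1,2,\dots,n\}$; (2) $T$ has a unique vertex with no outgoing edge, called the root; the vertices with no incoming edges are called leaves, and they form the set $L(T)$; (3) each internal vertex has valence $k+2$ (one outgoing and $k+1$ incoming edges); (4) the root has valence $t$ (i.e. $t$ incoming edges); (5) if the internal vertex $i$ lies on the path from the internal vertex $j\neq i$ to the root, then $i<j$. The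 leaves are unlabelled, but the planar structure gives a natural linear (left to right) order on $L(T)$, so leaves are numbered $1,\dots,|L(T)|$. Weight. Let $r_t$ be the rooted tree with $t$ leaves and no internal vertices. For $1\le i\le n$ let $c_i$ be the rooted tree with unique internal vertex $i$ and $k+1$ leaves. If $T$ is a planar rooted tree and $1\le l\le |L(T)|$, then $T\circ_l c_i$ is the planar rooted tree obtained by gluing the root of $c_i$ to the leaf numbered $l$ of $T$ to form a new edge; that is, leaf $l$ of $T$ is replaced by the internal vertex $i$, which has $k+1$ leaves attached. Each $T\in\mathrm{T}_{n,k}^t$ can be written in a unique way as $T=(\dots((r_t\circ_{l_1}c_1)\circ_{l_2}c_2)\dots)\circ_{l_n}c_n$, and its weight is $\omega(T)=\prod_{i=1}^{n}q^{l_i-1}\in\mathbb{N}[q]$. *)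

(* Defs.v *)
From HB Require Import structures.
From mathcomp Require Import all_boot all_order all_algebra.

Set Implicit Arguments.
Unset Strict Implicit.
Unset Printing Implicit Defensive.

Import GRing.Theory.

(* N[q] is {poly nat}, the polynomials over the semiring nat, with q := 'X.   *)

Definition qnat (m : nat) : {poly nat} := (\sum_(i < m) 'X^i)%R.

Definition qpoch (n k t : nat) : {poly nat} :=
  (\prod_(0 <= j < n) qnat (t + j * k))%R.

Definition qcard (x : finType) (w : x -> {poly nat}) : {poly nat} :=
  (\sum_(i : x) w i)%R.

(* A branch is what hangs from one incoming edge of a vertex: either a bare   *)
(* leaf, or an internal vertex carrying a label and the ordered list of the   *)
(* branches at its incoming edges.  A planar rooted tree is the ordered list  *)
(* of the branches at its root; the root itself is not labelled and is not an *)
(* internal vertex.  As leaves are unlabelled, equality of these terms is     *)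
(* isomorphism of planar rooted trees with labelled internal vertices.        *)
Definition branch := GenTree.tree unit.
Definition planar_tree := seq branch.
Notation leaf := (GenTree.Leaf tt : branch).

HB.instance Definition _ := Countable.on branch.
HB.instance Definition _ := Countable.on planar_tree.

Fixpoint labels (u : branch) : seq nat :=
  if u is GenTree.Node i us then i :: flatten (map labels us) else [::].

Definition internal_vertices (T : planar_tree) : seq nat :=
  flatten (map labels T).

Fixpoint nleaves (u : branch) : nat :=
  if u is GenTree.Node _ us then sumn (map nleaves us) else 1.

Definition num_leaves (T : planar_tree) : nat := sumn (map nleaves T).

Fixpoint incoming (d : nat) (u : branch) : bool :=
  if u is GenTree.Node _ us then (size us == d) && all (incoming d) us
  else true.

(* The internal vertices j != i whose path to the root goes through i are     *)
(* those occurring in the branches at the incoming edges of i.                *)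
Fixpoint increasing (u : branch) : bool :=
  if u is GenTree.Node i us then
    all (fun j => i < j) (flatten (map labels us)) && all increasing us
  else true.

Definition is_tree (n k t : nat) (T : planar_tree) : bool :=
  [&& perm_eq (internal_vertices T) (iota 1 n),
      all (incoming k.+1) T,
      size T == t
    & all increasing T].

Definition trees (n k t : nat) := {T : planar_tree | is_tree n k t T}.

HB.instance Definition _ n k t := SubCountable.on (trees n k t).

Definition corolla (k i : nat) : branch := GenTree.Node i (nseq k.+1 leaf).

(* Leaves are numbered from 1, left to right; grafting at an l that is not    *)
(* between 1 and the number of leaves is meaningless.                         *)
Definition graft_forest (g : branch -> nat -> branch) :=
  fix loop (us : seq branch) (l : nat) : seq branch :=
    if us is u :: us' then
      if l <= nleaves u then g u l :: us' else u :: loop us' (l - nleaves u)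
    else [::].

Fixpoint graft_branch (c u : branch) (l : nat) : branch :=
  if u is GenTree.Node i us then
    GenTree.Node i (graft_forest (graft_branch c) us l)
  else c.

Definition graft (T : planar_tree) (l : nat) (c : branch) : planar_tree :=
  graft_forest (graft_branch c) T l.

(* (...((r_t o_{l_1} c_1) o_{l_2} c_2)...) o_{l_n} c_n, where l_i = s`_(i-1). *)
Fixpoint grafts (k t : nat) (s : seq nat) (n : nat) : planar_tree :=
  if n is m.+1 then graft (grafts k t s m) (nth 0 s m) (corolla k m.+1)
  else nseq t leaf.

Definition is_decomposition (n k t : nat) (T : planar_tree) (s : seq nat) :=
  [&& size s == n,
      all (fun i => 1 <= nth 0 s i <= num_leaves (grafts k t s i)) (iota 0 n)
    & grafts k t s n == T].

Lemma forest_ind (P : branch -> Prop) (Q : seq branch -> Prop) :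
  P leaf -> (forall i us, Q us -> P (GenTree.Node i us)) ->
  Q [::] -> (forall u us, P u -> Q us -> Q (u :: us)) ->
  forall us, Q us.
Proof.
move=> Pl Pn Qn Qc.
have PP u : P u.
  elim: u => [[] //|i us IH]; apply: Pn.
  by elim: us IH => [//|u us IHus /= [Pu /IHus]]; apply: Qc.
by elim=> [//|u us Qus]; apply: Qc.
Qed.

Lemma labels_nil (us : seq branch) :
  flatten (map labels us) = [::] -> us = nseq (size us) leaf.
Proof. by elim: us => [//|[[]|i vs] us IH] //= /IH {1}->. Qed.

Lemma prune_forest k m (T : planar_tree) :
  all (incoming k.+1) T -> all increasing T ->
  all (fun j => j <= m) (internal_vertices T) ->
  count_mem m (internal_vertices T) = 1 ->
  exists T' l, [/\ 1 <= l <= num_leaves T', graft T' l (corolla k m) = T,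
    perm_eq (internal_vertices T) (m :: internal_vertices T')
    & [/\ size T' = size T, all (incoming k.+1) T' & all increasing T']].
Proof.
move: T; pose P u := incoming k.+1 u -> increasing u ->
  all (fun j => j <= m) (labels u) -> count_mem m (labels u) = 1 ->
  exists u' l, [/\ 1 <= l <= nleaves u',
    graft_branch (corolla k m) u' l = u,
    perm_eq (labels u) (m :: labels u') & incoming k.+1 u' && increasing u'].
apply: (@forest_ind P) => //.
- move=> i us IH; rewrite /P /=.
  move=> /andP[/eqP sz inc] /andP[lt incr] /andP[le1 le].
  have [im _ | nim /=] := eqVneq i m.
  + have us0 : flatten (map labels us) = [::] :> seq nat.
      case E: (flatten _) lt le => [//|j s] /=.
      by rewrite im => /andP[ltm _] /andP[]; rewrite leqNgt ltm.
    rewrite im; exists leaf, 1; split=> //; last by rewrite /= us0.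
    by rewrite /= (labels_nil us0) sz.
  rewrite add0n => /(IH inc incr le) [T' [l [hl hg hp [hs hi hI]]]].
  exists (GenTree.Node i T'), l; split=> //=.
  + by rewrite -[in RHS]hg.
  + rewrite perm_sym -[m :: _]/([:: m] ++ [:: i] ++ _) perm_catCA /=.
    by rewrite perm_cons perm_sym.
  rewrite hs sz eqxx hi hI /= andbT.
  by move: lt; rewrite (perm_all _ hp) /= => /andP[].
- move=> u us IHu IHus /= /andP[iu ius] /andP[cu cus].
  rewrite /internal_vertices /= all_cat count_cat => /andP[lu lus].
  have [mu c1|mu c1] := boolP (m \in labels u).
  + have cu1 : count_mem m (labels u) = 1.
      have : 0 < count_mem m (labels u) by rewrite -has_count has_pred1.
      by move: c1; case: (count_mem m (labels u)) => [|[|?]].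
    have [u' [l [/andP[l1 l2] hg hp /andP[h1 h2]]]] := IHu iu cu lu cu1.
    exists (u' :: us), l; split=> //=.
    * by rewrite l1 /num_leaves /= (leq_trans l2) ?leq_addr.
    * by rewrite /graft /= l2 hg.
    * by rewrite -cat_cons perm_cat2r.
    * by rewrite h1 h2 ius cus.
  + move: c1; rewrite (count_memPn mu) add0n => c1.
    have [T' [l [/andP[l1 l2] hg hp [h0 h1 h2]]]] := IHus ius cus lus c1.
    exists (u :: T'), (nleaves u + l); split=> //=.
    * by rewrite addn_gt0 l1 orbT /num_leaves /= leq_add2l.
    * rewrite /graft /= leqNgt -[X in X < _]addn0 ltn_add2l l1 /= addKn.
      by congr (_ :: _).
    * rewrite perm_sym -(cat1s m) perm_catCA perm_cat2l perm_sym.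
      exact: hp.
    * by rewrite h0 h1 h2 iu cu.
Qed.

Lemma eq_grafts k t s s' n :
  (forall i, i < n -> nth 0 s i = nth 0 s' i) ->
  grafts k t s n = grafts k t s' n.
Proof.
elim: n => [//|n IH] E /=; rewrite E // IH // => i lti.
by apply: E; apply: ltnW.
Qed.

Lemma decomposition_rcons n k t T s l :
  is_decomposition n k t T s -> 1 <= l <= num_leaves T ->
  is_decomposition n.+1 k t (graft T l (corolla k n.+1)) (rcons s l).
Proof.
move=> /and3P[/eqP sz hs /eqP <-] hl; apply/and3P.
have E i : i < n -> nth 0 (rcons s l) i = nth 0 s i.
  by move=> lti; rewrite nth_rcons sz lti.
have G i : i <= n -> grafts k t (rcons s l) i = grafts k t s i.
  by move=> lei; apply: eq_grafts => j ltj; apply/E/(leq_trans ltj).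
have El : nth 0 (rcons s l) n = l by rewrite nth_rcons sz ltnn eqxx.
split; first by rewrite size_rcons sz.
- rewrite -[n.+1]addn1 (iotaD 0 n 1) all_cat /= andbT add0n El G //.
  rewrite hl andbT; apply/allP=> i iin.
  have lti : i < n by move: iin; rewrite mem_iota.
  by rewrite E // (G i (ltnW lti)); exact: (allP hs i iin).
- by rewrite /= El G.
Qed.

Lemma decomposition_exists n k t (T : planar_tree) :
  is_tree n k t T -> exists s, is_decomposition n k t T s.
Proof.
elim: n T => [|n IH] T /and4P[hp hi /eqP hs hI].
  exists [::]; apply/and3P; split=> //=; move: hp; rewrite -hs.
  by rewrite /= => /perm_nilP /labels_nil {2}->.
have le : all (fun j => j <= n.+1) (internal_vertices T).
  by rewrite (perm_all _ hp); apply/allP=> j; rewrite mem_iota add1n => /andP[].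
have c1 : count_mem n.+1 (internal_vertices T) = 1.
  rewrite (permP hp) count_uniq_mem ?iota_uniq // mem_iota.
  by rewrite add1n ltnSn.
have [T' [l [hl hg hp' [sz' hi' hI']]]] := prune_forest hi hI le c1.
suff /IH[s hd] : is_tree n k t T'.
  by exists (rcons s l); rewrite -hg; apply: decomposition_rcons.
apply/and4P; split=> //; last by rewrite sz' hs.
have: perm_eq (n.+1 :: internal_vertices T') (n.+1 :: iota 1 n).
  have E : iota 1 n.+1 = iota 1 n ++ [:: n.+1].
    by rewrite -[n.+1]addn1 (iotaD 1 n 1) add1n addn1.
  by rewrite -(permPl hp') (permPl hp) E perm_catC.
by rewrite perm_cons.
Qed.

Lemma mem_graft c m (T : planar_tree) l :
  m \in labels c -> 1 <= l <= num_leaves T ->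
  m \in internal_vertices (graft T l c).
Proof.
move=> mc; move: T l; pose P u := forall l, 1 <= l <= nleaves u ->
  m \in labels (graft_branch c u l).
apply: (@forest_ind P) => //.
- by move=> i us IH l hl /=; rewrite inE [X in _ || X]IH ?orbT.
- by move=> l /=; case: l.
move=> u us IHu IHus l /andP[l1 l2]; rewrite /graft /=.
case: leqP => h; rewrite /internal_vertices /= mem_cat.
  by rewrite IHu ?l1.
rewrite [X in _ || X]IHus ?orbT // subn_gt0 h /=.
by rewrite leq_subLR.
Qed.

Lemma mem_graft_branch c m u l :
  m \in labels c -> 1 <= l <= nleaves u -> m \in labels (graft_branch c u l).
Proof.
move=> mc /andP[l1 l2].
have := @mem_graft c m [:: u] l mc.
by rewrite /num_leaves /internal_vertices /graft /= addn0 l1 l2 /= cats0; apply.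
Qed.

Lemma graft_inj k m (T T' : planar_tree) l l' :
  m \notin internal_vertices T -> m \notin internal_vertices T' ->
  1 <= l <= num_leaves T -> 1 <= l' <= num_leaves T' ->
  graft T l (corolla k m) = graft T' l' (corolla k m) -> T = T' /\ l = l'.
Proof.
set c := corolla k m; have mc : m \in labels c by rewrite /= inE eqxx.
move: T T' l l'; pose P u := forall u' l l',
  m \notin labels u -> m \notin labels u' ->
  1 <= l <= nleaves u -> 1 <= l' <= nleaves u' ->
  graft_branch c u l = graft_branch c u' l' -> u = u' /\ l = l'.
have one l : 1 <= l <= 1 -> l = 1 by case: l => [|[|]].
apply: (@forest_ind P).
- move=> [[]|i us] l l' _ /=; first by move=> _ /one-> /one->.
  by rewrite inE negb_or => /andP[/eqP nm _] _ _ [/nm].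
- move=> i us IH [[]|i' us'] l l' /=; rewrite inE negb_or => /andP[/eqP nm mus].
    by move=> _ _ _ [/esym/nm].
  rewrite inE negb_or => /andP[_ mus'] hl hl' [-> E].
  by have [-> ->] := IH us' l l' mus mus' hl hl' E.
- by move=> T' [].
move=> u us IHu IHus [|u' us'] l l'; first by move=> _ _ _; case: l'.
rewrite /internal_vertices /num_leaves /= !mem_cat !negb_or.
move=> /andP[mu mus] /andP[mu' mus'] /andP[l1 l2] /andP[l1' l2'].
rewrite /graft /=; case: leqP => h; case: leqP => h' [E1 E2].
- have [|//|-> ->] := IHu u' l l' mu mu' _ _ E1; rewrite ?l1 ?l1' //.
  by rewrite E2.
- by move: mu'; rewrite -E1 mem_graft_branch ?l1.
- by move: mu; rewrite E1 mem_graft_branch ?l1'.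
- move: h h'; subst u' => h h'.
  have [||-> E] := IHus us' (l - nleaves u) (l' - nleaves u) mus mus' _ _ E2.
  + by rewrite subn_gt0 h leq_subLR.
  + by rewrite subn_gt0 h' leq_subLR.
  by split=> //; rewrite -(subnK (ltnW h)) E subnK // ltnW.
Qed.

Lemma sub_labels_graft c m (T : planar_tree) l :
  m \in internal_vertices (graft T l c) ->
  (m \in internal_vertices T) || (m \in labels c).
Proof.
move: T l; pose P u := forall l, m \in labels (graft_branch c u l) ->
  (m \in labels u) || (m \in labels c).
apply: (@forest_ind P) => //.
- by move=> i us IH l /=; rewrite !inE -orbA => /orP[-> //|/IH->]; rewrite orbT.
- move=> u us IHu IHus l; rewrite /graft /internal_vertices /=.
  case: ifP => _ /=; rewrite !mem_cat => /orP[].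
  + by move/IHu/orP=> [] ->; rewrite ?orbT.
  + by move=> ->; rewrite orbT.
  + by move=> ->.
  + by move/IHus; rewrite -orbA => ->; rewrite orbT.
Qed.

Lemma internal_vertices_grafts k t s n m :
  m \in internal_vertices (grafts k t s n) -> m <= n.
Proof.
elim: n => [|n IH] /=; first by elim: t.
case/sub_labels_graft/orP => [/IH /leqW //|].
rewrite /= inE => /orP[/eqP-> //|].
by rewrite (_ : flatten _ = [::]) //; elim: (k).
Qed.

Lemma decomposition_uniq n k t T s s' :
  is_decomposition n k t T s -> is_decomposition n k t T s' -> s = s'.
Proof.
move=> /and3P[/eqP sz hs /eqP <-] /and3P[/eqP sz' hs' /eqP E].
apply: (@eq_from_nth _ 0); rewrite sz ?sz' // => i; move: i.
elim: n hs hs' E {sz sz'} => [//|n IH] hs hs' /= E i lei.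
have hn : n \in iota 0 n.+1 by rewrite mem_iota ltnSn.
have sub : {subset iota 0 n <= iota 0 n.+1}.
  by move=> j; rewrite !mem_iota /= => /leqW.
have fresh s0 : n.+1 \notin internal_vertices (grafts k t s0 n).
  by apply/negP => /internal_vertices_grafts; rewrite ltnn.
have [E1 E2] := graft_inj (fresh _) (fresh _)
  (allP hs' n hn) (allP hs n hn) E.
move: lei; rewrite ltnS leq_eqVlt => /orP[/eqP -> //|].
by apply: IH E1 i; apply/allP=> j /sub; [apply: (allP hs)|apply: (allP hs')].
Qed.

Lemma num_leaves_graft c (T : planar_tree) l : 1 <= l <= num_leaves T ->
  num_leaves (graft T l c) = (num_leaves T).-1 + nleaves c.
Proof.
move: T l; pose P u := forall l, 1 <= l <= nleaves u ->
  nleaves (graft_branch c u l) = (nleaves u).-1 + nleaves c.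
apply: (@forest_ind P) => //; first by move=> l; case: l.
move=> u us IHu IHus l /andP[l1 l2]; rewrite /graft /num_leaves /=.
case: leqP => h /=.
  rewrite IHu ?l1 //; case: (nleaves u) (leq_trans l1 h) => //= a _.
  by rewrite addnAC.
have hl : 1 <= l - nleaves u <= num_leaves us.
  by rewrite subn_gt0 h leq_subLR.
rewrite [X in _ + X]IHus //; case/andP: hl => /leq_trans a /a pos.
by rewrite addnA -[sumn _]/(num_leaves us) -[in RHS](prednK pos) addnS.
Qed.

Lemma num_leaves_grafts n k t T s i :
  is_decomposition n k t T s -> i <= n ->
  num_leaves (grafts k t s i) = t + i * k.
Proof.
move=> /and3P[_ hs _]; elim: i => [|i IH] lei.
  by rewrite addn0 /=; elim: t {hs} => //= t; rewrite /num_leaves /= => ->.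
have hi : i \in iota 0 n by rewrite mem_iota.
have hl := allP hs i hi; rewrite /= num_leaves_graft //.
case/andP: hl => /leq_trans a /a; rewrite (IH (ltnW lei)) => pos.
have -> : nleaves (corolla k i.+1) = k.+1.
  by rewrite /=; congr _.+1; elim: k {hs IH hi a pos} => //= k ->.
by rewrite mulSn addnCA; case: (t + i * k) pos => // b _; rewrite !addnS addnC.
Qed.

Section Trees.
Variables n k t : nat.
Implicit Type T : trees n k t.

(* The sequence (l_1, ..., l_n); it is unique by decomposition_uniq.          *)
Definition decomposition T : seq nat :=
  xchoose (decomposition_exists (valP T)).

Lemma decompositionP T : is_decomposition n k t (val T) (decomposition T).
Proof. exact: xchooseP. Qed.

Definition weight T : {poly nat} :=
  (\prod_(l <- decomposition T) 'X^(l - 1)%N)%R.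

Definition trees_code T : n.-tuple 'I_(t + n * k).+1 :=
  [tuple inord (nth 0 (decomposition T) i) | i < n].

Definition trees_decode (c : n.-tuple 'I_(t + n * k).+1) :
    option (trees n k t) :=
  insub (grafts k t (map val c) n).

Lemma trees_codeK : pcancel trees_code trees_decode.
Proof.
move=> T; have h := decompositionP T.
rewrite /trees_decode (_ : grafts _ _ _ _ = val T) ?valK //.
have /and3P[_ hs /eqP <-] := h; apply: eq_grafts => i lti.
rewrite (nth_map ord0) ?size_tuple // -[i]/(val (Ordinal lti)).
rewrite -tnth_nth tnth_mktuple [val _]inordK //= ltnS.
have iin : i \in iota 0 n by rewrite mem_iota.
have /andP[_] := allP hs i iin.
rewrite (num_leaves_grafts h) ?(ltnW lti) // => /leq_trans; apply.
by rewrite leq_add2l leq_mul2r (ltnW lti) orbT.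
Qed.

HB.instance Definition _ : isFinite (trees n k t) :=
  PCanIsFinite trees_codeK.

End Trees.

(* Main.v *)
(* Grafting corollas is a bijection from the sequences (l_1, ..., l_n) with
   1 <= l_i <= t + (i-1)k onto the trees, since the tree obtained after i
   graftings has t + ik leaves. The sum of the weights over these sequences
   factors as the product of the [t + jk]_q. *)

Require Import Defs.
From mathcomp Require Import all_boot all_order all_algebra.

Set Implicit Arguments.
Unset Strict Implicit.
Unset Printing Implicit Defensive.

Import GRing.Theory.

(** * Stability of the tree conditions under grafting *)

Lemma perm_internal_vertices_graft c (T : planar_tree) l :
  1 <= l <= num_leaves T ->
  perm_eq (internal_vertices (graft T l c)) (labels c ++ internal_vertices T).
Proof.
move: T l; pose P u := forall l, 1 <= l <= nleaves u ->
  perm_eq (labels (graft_branch c u l)) (labels c ++ labels u).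
apply: (@forest_ind P); rewrite /P.
- by move=> l _ /=; rewrite cats0.
- move=> i us IH l hl /=; rewrite perm_sym -[i :: _]cat1s perm_catCA /=.
  by rewrite perm_cons perm_sym; apply: IH.
- by case.
move=> u us IHu IHus l /andP[l1 l2]; rewrite /graft /internal_vertices /=.
case: leqP => h /=; first by rewrite catA perm_cat2r IHu ?l1.
rewrite perm_sym perm_catCA perm_cat2l perm_sym; apply: IHus.
by rewrite subn_gt0 h leq_subLR.
Qed.

Lemma size_graft c (T : planar_tree) l : size (graft T l c) = size T.
Proof.
elim: T l => //= u us IH l; rewrite /graft /=; case: ifP => //= _.
by rewrite [size _]IH.
Qed.

Lemma incoming_graft d c (T : planar_tree) l :
  incoming d c -> all (incoming d) T -> all (incoming d) (graft T l c).
Proof.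
move=> dc; move: T l; pose P u := forall l, incoming d u ->
  incoming d (graft_branch c u l).
apply: (@forest_ind P) => //;
  [move=> i us IH l /andP[sz du]|move=> u us IHu IHus l /andP[du dus]].
  by rewrite /= [size _]size_graft sz; apply: IH.
by rewrite /graft /=; case: ifP => _ /=; rewrite ?IHu ?du //; apply: IHus.
Qed.

(** The new pairs (ancestor, descendant) have their ancestor in [T] and their descendant in [c], so
    comparing these two sets of labels suffices. *)
Lemma increasing_graft c (T : planar_tree) l :
  increasing c -> {in internal_vertices T & labels c, forall i j, i < j} ->
  all increasing T -> all increasing (graft T l c).
Proof.
move=> cc; move: T l; pose P u := forall l,
  {in labels u & labels c, forall i j, i < j} -> increasing u ->
  increasing (graft_branch c u l).
apply: (@forest_ind P) => //.
- move=> i us IH l lt /andP[ltus cus] /=; apply/andP; split; last first.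
    by apply: IH cus => a b ha; apply: lt; rewrite inE ha orbT.
  apply/allP => j /sub_labels_graft/orP[|jc]; first exact: (allP ltus).
  by apply: lt; rewrite ?inE ?eqxx.
move=> u us IHu IHus l lt /andP[cu cus].
have ltu : {in labels u & labels c, forall i j, i < j}.
  by move=> a b ha; apply: lt; rewrite /internal_vertices /= mem_cat ha.
have ltus : {in internal_vertices us & labels c, forall i j, i < j}.
  move=> a b ha; apply: lt.
  by rewrite /internal_vertices /= mem_cat [X in _ || X]ha orbT.
by rewrite /graft /=; case: ifP => _ /=; rewrite ?IHu ?cu //; apply: IHus.
Qed.

Lemma labels_corolla k i : labels (corolla k i) = [:: i].
Proof. by rewrite /= (_ : flatten _ = [::]) //; elim: k. Qed.

Lemma is_tree_graft n k t (T : planar_tree) l :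
  is_tree n k t T -> 1 <= l <= num_leaves T ->
  is_tree n.+1 k t (graft T l (corolla k n.+1)).
Proof.
case/and4P=> pT iT /eqP sT cT hl; apply/and4P; split.
- rewrite (permPl (perm_internal_vertices_graft _ hl)) labels_corolla.
  have -> : iota 1 n.+1 = iota 1 n ++ [:: n.+1].
    by rewrite -[n.+1]addn1 (iotaD 1 n 1) add1n addn1.
  by rewrite perm_sym perm_catC perm_cat2l perm_sym.
- by apply: incoming_graft iT; rewrite /= size_nseq eqxx all_nseq orbT.
- by rewrite size_graft sT.
apply: increasing_graft cT.
  (* Cancelling the head label shows that nothing above the vertex of the corolla is labelled, so
     the order condition there is vacuous. *)
  have [] := (labels_corolla k n.+1).
  by rewrite /= => -> /=; rewrite all_nseq orbT.
move=> i j; rewrite labels_corolla (perm_mem pT) mem_iota inE add1n.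
by case/andP=> _ lti /eqP->.
Qed.

(** Converse of [decomposition_exists]; it makes every admissible sequence an honest element of
    [trees n k t]. *)
Lemma decomposition_is_tree n k t (T : planar_tree) s :
  is_decomposition n k t T s -> is_tree n k t T.
Proof.
move=> /and3P[_ + /eqP <-]; elim: n => [_|n IH hs] /=.
  apply/and4P; split; rewrite ?size_nseq // ?all_nseq ?orbT //.
  by rewrite (_ : internal_vertices _ = [::]) //; elim: t.
apply: is_tree_graft.
  apply: IH; apply/allP => i; rewrite mem_iota => /= lti; apply: (allP hs).
  by rewrite mem_iota leqW.
by apply: (allP hs); rewrite mem_iota /=.
Qed.

(** Each graft adds exactly k leaves, so the admissible range for a position does not depend on the
    earlier choices. *)
Lemma is_decomposition_grafts n k t s :
  size s = n -> (forall i, i < n -> 1 <= nth 0 s i <= t + i * k) ->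
  is_decomposition n k t (grafts k t s n) s.
Proof.
elim: n s => [|n IH] s.
  by move=> /size0nil ->; rewrite /is_decomposition /= eqxx.
case/lastP: s => // s l; rewrite size_rcons => -[sz] hs /=.
have E i : i < n -> nth 0 (rcons s l) i = nth 0 s i.
  by move=> lti; rewrite nth_rcons sz lti.
have El : nth 0 (rcons s l) n = l by rewrite nth_rcons sz ltnn eqxx.
have hd : is_decomposition n k t (grafts k t s n) s.
  by apply: IH => // i lti; rewrite -E //; apply/hs/leqW.
rewrite (eq_grafts _ _ E) El; apply: (decomposition_rcons hd).
by rewrite (num_leaves_grafts hd) // -[l in _ <= l <= _]El hs.
Qed.

(** * Trees as bounded functions of exponents *)

Section Positions.
Variables n k t : nat.
Implicit Type T : trees n k t.

Lemma size_decomposition T : size (decomposition T) = n.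
Proof. by have /and3P[/eqP] := decompositionP T. Qed.

Lemma nth_decomposition_bound T i :
  i < n -> 1 <= nth 0 (decomposition T) i <= t + i * k.
Proof.
move=> lti; have hd := decompositionP T.
rewrite -(num_leaves_grafts hd (ltnW lti)).
by case/and3P: hd => _ /allP/(_ i) + _; rewrite mem_iota; apply.
Qed.

Lemma decomposition_inj : injective (@decomposition n k t).
Proof.
move=> T T' E; apply: val_inj.
have /and3P[_ _ /eqP <-] := decompositionP T.
by have /and3P[_ _ /eqP <-] := decompositionP T'; rewrite E.
Qed.

(* Positions are numbered from 0 here, so that they are the exponents of q. *)
Definition position T : {ffun 'I_n -> 'I_(t + n * k).+1} :=
  [ffun i => inord (nth 0 (decomposition T) (val i)).-1].

Lemma positionE T (i : 'I_n) :
  val (position T i) = (nth 0 (decomposition T) i).-1.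
Proof.
(* [inord] does not fall back to its default value: the exponent is at most t + ik, hence at most t
   + nk. *)
rewrite ffunE /= inordK // ltnS.
have /andP[_] := nth_decomposition_bound T (ltn_ord i).
move/(leq_trans (leq_pred _))/leq_trans; apply.
by rewrite leq_add2l leq_mul2r ltnW ?orbT.
Qed.

Lemma position_inj : injective position.
Proof.
move=> T T' E; apply/decomposition_inj/(@eq_from_nth _ 0).
  by rewrite !size_decomposition.
rewrite size_decomposition => i lti.
have /andP[p _] := nth_decomposition_bound T lti.
have /andP[p' _] := nth_decomposition_bound T' lti.
(* Leaf numbers are positive, so they are recovered from their predecessors. *)
rewrite -(prednK p) -(prednK p').
by rewrite -(positionE T (Ordinal lti)) -(positionE T' (Ordinal lti)) E.
Qed.

(** All exponents share one codomain, so the bound depending on i is carried by a [family], the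
    index set produced by distributing a product over sums. *)
Lemma codom_position :
  codom position =i family (fun i : 'I_n => [pred j : 'I__ | j < t + i * k]).
Proof.
move=> f; apply/codomP/familyP => [[T ->] i|hf].
  rewrite inE positionE.
  have /andP[p] := nth_decomposition_bound T (ltn_ord i).
  by rewrite -ltnS prednK.
(* The successor turns exponents back into leaf numbers. *)
pose s := [seq (val (f i)).+1 | i : 'I_n].
have nths (i : 'I_n) : nth 0 s i = (val (f i)).+1.
  by rewrite (nth_map i) ?size_enum_ord // nth_ord_enum.
have hd : is_decomposition n k t (grafts k t s n) s.
  apply: is_decomposition_grafts; first by rewrite size_map size_enum_ord.
  by move=> i lti; rewrite (nths (Ordinal lti)); apply: hf (Ordinal lti).
exists (Sub _ (decomposition_is_tree hd)).
apply/ffunP => i; apply: val_inj; rewrite positionE.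
set T := Sub _ _; have hT := decompositionP T; rewrite SubK in hT.
(* [decomposition] is obtained by choice; uniqueness identifies it with [s]. *)
by rewrite (decomposition_uniq hT hd) nths.
Qed.

Lemma weightE T : weight T = (\prod_(i < n) 'X^(position T i))%R.
Proof.
rewrite /weight (big_nth 0) size_decomposition big_mkord.
by apply: eq_bigr => i _; rewrite positionE subn1.
Qed.

End Positions.

Theorem theorem6 (t k n : nat) (t_ge1 : 1 <= t) (k_ge1 : 1 <= k) :
  qpoch n k t = qcard (@weight n k t).
Proof.
rewrite /qpoch /qcard big_mkord.
(* Distributivity needs all the sums to range over a common index type. *)
have qnatE (i : 'I_n) : qnat (t + i * k) =
    (\sum_(j : 'I_(t + n * k).+1 | (j < t + i * k)%N) 'X^j)%R.
  apply: (big_ord_widen _ (fun j => 'X^j)%R).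
  by rewrite leqW // leq_add2l leq_mul2r ltnW ?orbT.
rewrite (eq_bigr _ (fun i _ => qnatE i)) bigA_distr_big_dep.
under [RHS]eq_bigr do rewrite weightE.
rewrite -(eq_bigl _ _ (@codom_position n k t)).
(* Injectivity of [position] makes its image list duplicate-free, so the sum over the image is the
   sum over trees. *)
rewrite -big_uniq ?big_image // map_inj_uniq ?enum_uniq //.
exact: position_inj.
Qed.
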